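(* Let $X$ be a real Banach space and let $f:\mathbb{R}\to X$ be pointwise-Lipschitz. Then the set $\{x\in\mathbb{R}: mD_+(f,x)\neq mD_-(f,x)\}$ is $\sigma$-porous.
   Context: A mapping $f:\mathbb{R}\to X$ is pointwise-Lipschitz if $\limsup_{y\to x}\frac{\|f(x)-f(y)\|}{|x-y|}<\infty$ for every $x\in\mathbb{R}$. The unilateral lower metric derived numbers are $mD_{\pm}(f,x)=\liminf_{t\to0+}\frac{\|f(x\pm t)-f(x)\|}{t}$. Porosity: for $M\subset\mathbb{R}$, $x\in M$, $R>0$, let $\gamma(x,R,M)$ be the supremum of all $r>0$ for which there exists $z\in\mathbb{R}$ with $B(z,r)\subset B(x,R)\setminus M$, where $B(z,r)=(z-r,z+r)$ (the supremum is $0$ if there is no such $r$). The upper porosity of $M$ at $x$ is $\overline{p}(M,x)=2\limsup_{R\to0+}\gamma(x,R,M)/R$. The set $M$ is porous if $\overline{p}(M,x)>0$ for all $x\in M$. A set $N\subset\mathbb{R}$ is $\sigma$-porous if it is a countable union of porous sets. *)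

(* Defs.v *)
From HB Require Import structures.
From mathcomp Require Import all_boot all_order all_algebra.
From mathcomp Require Import all_classical all_reals all_analysis.

Set Implicit Arguments.
Unset Strict Implicit.
Unset Printing Implicit Defensive.

Import Order.TTheory GRing.Theory Num.Theory.
Import numFieldNormedType.Exports.

Local Open Scope classical_set_scope.
Local Open Scope ring_scope.

Definition pointwise_lipschitz (R : realType) (X : normedModType R)
    (f : R -> X) : Prop :=
  forall x : R,
    (limf_esup (fun y : R => (`|f x - f y| / `|x - y|)%:E) x^' < +oo)%E.

Definition mD_plus (R : realType) (X : normedModType R)
    (f : R -> X) (x : R) : \bar R :=
  limf_einf (fun t : R => (`|f (x + t) - f x| / t)%:E) 0^'+.

Definition mD_minus (R : realType) (X : normedModType R)
    (f : R -> X) (x : R) : \bar R :=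
  limf_einf (fun t : R => (`|f (x - t) - f x| / t)%:E) 0^'+.

(* The set of radii is bounded above by [rho], and [sup set0 = 0], so the
   real-valued [sup] is the supremum, with value 0 if there is no such [r]. *)
Definition porosity_gamma (R : realType) (x rho : R) (M : set R) : R :=
  sup [set r : R | 0 < r /\ exists z : R, ball z r `<=` ball x rho `\` M].

Definition upper_porosity (R : realType) (M : set R) (x : R) : \bar R :=
  (2%:E * limf_esup (fun rho : R => (porosity_gamma x rho M / rho)%:E) 0^'+)%E.

Definition porous (R : realType) (M : set R) : Prop :=
  forall x : R, M x -> (0 < upper_porosity M x)%E.

(* [set0] is porous, so finite unions are included. *)
Definition sigma_porous (R : realType) (N : set R) : Prop :=
  exists F : nat -> set R, (forall n, porous (F n)) /\ N = \bigcup_n F n.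

(* Main.v *)
Require Import Defs.
From HB Require Import structures.
From mathcomp Require Import all_boot all_order all_algebra.
From mathcomp Require Import all_classical all_reals all_analysis.
From mathcomp Require Import ring lra.
Import Order.TTheory GRing.Theory Num.Theory.
Import numFieldNormedType.Exports.
Local Open Scope classical_set_scope.
Local Open Scope ring_scope.

(** Suppose that at [x] the lower derived number in the direction [e = 1] or
    [e = -1] is below [p], the one in the direction [- e] is above [q > p], and
    that both the latter bound and the Lipschitz bound with constant [L] hold at
    scale [1 / L].  The set of all such [x] is porous: choose a small [t] with
    [|f (x + e t) - f x| < p t] and let [y = x + e t].  A point [z] of the set at
    distance [s] from [y] satisfies
    [q (t - s) <= |f z - f x| < p t + L s], so [s > t (q - p) / (L + q)].
    Letting [p], [q] be rational and [L] a positive integer gives countably many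
    porous sets. *)

Lemma lte_dense_real (R : realType) (a b : \bar R) :
  (a < b)%E -> exists r : R, (a < r%:E)%E /\ (r%:E < b)%E.
Proof.
case: a b => [a| |] [b| |] //= ab.
- by exists ((a + b) / 2); move: ab; rewrite !lte_fin => ab; split; lra.
- by exists (a + 1); rewrite lte_fin ltry; split => //; lra.
- by exists (b - 1); rewrite lte_fin ltNyr; split => //; lra.
- by exists 0; rewrite ltry ltNyr.
Qed.

Lemma lte_dense_rat2 (R : realType) (a b : \bar R) : (a < b)%E ->
  exists p q : rat, [/\ (a < (ratr p : R)%:E)%E, (ratr p : R) < ratr q
    & ((ratr q : R)%:E < b)%E].
Proof.
move=> /lte_dense_real[r [ar]] /lte_dense_real[s [rs sb]].
rewrite lte_fin in rs.
have [p] := rat_in_itvoo rs; rewrite in_itv /= => /andP[rp ps].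
have [q] := rat_in_itvoo ps; rewrite in_itv /= => /andP[pq qs].
exists p, q; split => //.
- by apply: lt_trans ar _; rewrite lte_fin.
- by apply: lt_trans sb; rewrite lte_fin.
Qed.

Section limf.
Context {T : choiceType} {X : filteredType T} {R : realType}.
Implicit Types (g : X -> \bar R) (F : set (set X)).

Lemma limf_esup_lt g F a : (limf_esup g F < a)%E ->
  exists2 V, F V & forall x, V x -> (g x < a)%E.
Proof.
move=> /ereal_inf_lt[_ [V FV <-]] Va; exists V => // x Vx.
by apply: le_lt_trans Va; apply: ereal_sup_ubound; exists x.
Qed.

Lemma limf_einf_gt g F a : (a < limf_einf g F)%E ->
  exists2 V, F V & forall x, V x -> (a < g x)%E.
Proof.
rewrite /limf_einf lteNr => /limf_esup_lt[V FV Vg].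
by exists V => // x /Vg; rewrite lteN2.
Qed.

Lemma limf_einf_lt g F a V : (limf_einf g F < a)%E -> F V ->
  exists2 x, V x & (g x < a)%E.
Proof.
rewrite /limf_einf lteNl => aF FV.
have : (- a < ereal_sup [set (- g x)%E | x in V])%E.
  by apply: lt_le_trans aF _; apply: ereal_inf_lbound; exists V.
by move=> /ereal_sup_gt[_ [x Vx <-]]; rewrite lteN2; exists x.
Qed.

End limf.

Lemma at_right0_ex (R : realType) (V : set R) : 0^'+ V ->
  exists2 d : R, 0 < d & forall t, 0 < t < d -> V t.
Proof.
move=> [d /= d0 dV]; exists d => // t /andP[t0 td]; apply: dV => //=.
by rewrite sub0r normrN gtr0_norm.
Qed.

Lemma le_porosity_gamma (R : realType) (M : set R) (x rho r z : R) : 0 < r ->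
  ball z r `<=` ball x rho `\` M -> r <= porosity_gamma x rho M.
Proof.
move=> r0 zr; apply: ub_le_sup; last by split=> //; exists z.
(* The real [sup] needs an upper bound, here [rho]: if [rho < s], then [w + rho] and [w - rho] both
   lie in [ball x rho], which forces both [w < x] and [x < w]. *)
exists rho => s [s0 [w ws]]; rewrite leNgt; apply/negP => rs.
have h u : `|u| < s -> `|u + w - x| < rho.
  move=> us; have [] := ws (u + w).
    by rewrite -ball_normE /= (_ : w - (u + w) = - u) ?normrN//; ring.
  by rewrite -ball_normE /= distrC.
have rho0 : 0 < rho by apply: le_lt_trans (h 0 _); rewrite ?normr0.
have := h rho; rewrite gtr0_norm// => /(_ rs); rewrite ltr_norml => /andP[_ h1].
have := h (- rho); rewrite normrN gtr0_norm// => /(_ rs).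
by rewrite ltr_norml => /andP[h2 _]; lra.
Qed.

Lemma upper_porosity_gt0 (R : realType) (M : set R) (x c : R) : 0 < c ->
  (forall d, 0 < d -> exists rho z, [/\ 0 < rho, rho < d
     & ball z (c * rho) `<=` ball x rho `\` M]) ->
  (0 < upper_porosity M x)%E.
Proof.
move=> c0 hM; rewrite /upper_porosity mule_gt0 ?lte_fin//.
apply: (@lt_le_trans _ _ c%:E); first by rewrite lte_fin.
apply: le_ereal_inf_tmp => _ [V /at_right0_ex[d d0 dV] <-].
have [rho [z [rho0 rhod zM]]] := hM _ d0.
apply: (@le_trans _ _ (porosity_gamma x rho M / rho)%:E); last first.
  by apply: ereal_sup_ubound; exists rho => //; apply: dV; rewrite rho0.
rewrite lee_fin ler_pdivlMr//; apply: le_porosity_gamma zM.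
by rewrite mulr_gt0.
Qed.

Section derived_numbers.
Context {R : realType} {X : normedModType R}.
Variable f : R -> X.

(** The direction [e] is 1 or -1 in every use, so one argument serves both sides. *)
Definition mD (e x : R) : \bar R :=
  limf_einf (fun t : R => (`|f (x + e * t) - f x| / t)%:E) 0^'+.

Lemma mD_plusE x : mD_plus f x = mD 1 x.
Proof. by congr limf_einf; apply/funext => t; rewrite mul1r. Qed.

Lemma mD_minusE x : mD_minus f x = mD (- 1) x.
Proof. by congr limf_einf; apply/funext => t; rewrite mulN1r. Qed.

(** [L] is both the Lipschitz constant and the inverse of the scale, so one integer indexes both
    bounds. The strict bounds on [mD] force the two derived numbers to differ at every member. *)
Definition mD_gap (e p q L : R) : set R :=
  [set x | [/\ (mD e x < p%:E)%E, p < q, (q%:E < mD (- e) x)%E,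
    forall y, `|x - y| < L^-1 -> `|f x - f y| <= L * `|x - y|
  & forall t, 0 < t < L^-1 -> q * t <= `|f (x - e * t) - f x|]].

Lemma porous_mD_gap (e p q L : R) : `|e| = 1 -> 0 < L ->
  porous (mD_gap e p q L).
Proof.
move=> e1 L0 x [xp pq _ _ _].
have ee : e * e = 1.
  by rewrite -[LHS]ger0_norm ?normrM ?e1 ?mulr1// -expr2 sqr_ge0.
(* Some nonnegative difference quotient lies below [p]. *)
have p0 : 0 < p.
  have [] := limf_einf_lt _ _ _ _ xp (nbhs_right_gt (0 : R)).
  move=> t t0; rewrite lte_fin; apply: le_lt_trans.
  by rewrite divr_ge0// ltW.
have Lq0 : 0 < L + q by lra.
(* The threshold at which [q (t - s) < p t + L s] first fails to be contradictory is [s = c t]. *)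
pose c := (q - p) / (L + q).
have c0 : 0 < c by rewrite divr_gt0// subr_gt0.
have c1 : c < 1 by rewrite ltr_pdivrMr//; lra.
have cE : c * (L + q) = q - p by rewrite divfK// gt_eqF.
apply: (@upper_porosity_gt0 _ _ _ (c / 2)); first by rewrite divr_gt0.
move=> d d0.
have iL0 : 0 < L^-1 by rewrite invr_gt0.
(* The first bound gives [2 t < d]; the second gives [t + s < 2 t < 1 / L], since [|s| < c t < t]
   below. *)
pose d' := Num.min (d / 2) (L^-1 / 2).
have d'0 : 0 < d' by rewrite lt_min !divr_gt0.
have nd' : 0^'+ [set t : R | 0 < t /\ t < d'].
  exists d' => //= t /=; rewrite sub0r normrN => td t0.
  by split=> //; move: td; rewrite gtr0_norm.
have [t [t0]] := limf_einf_lt _ _ _ _ xp nd'.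
rewrite lt_min => /andP[td tL]; rewrite lte_fin ltr_pdivrMr// => xt.
(* Radius [2 t] suffices: the centre is at distance [t] from [x] and the hole has radius
   [c t < t]. *)
exists (2 * t), (x + e * t); split; [by rewrite mulr_gt0|by lra|].
have -> : c / 2 * (2 * t) = c * t by field.
move=> z; rewrite -ball_normE /= => zy.
have ct : c * t < t by rewrite gtr_pMl.
have net : `|e * t| = t by rewrite normrM e1 mul1r gtr0_norm.
split.
  have -> : x - z = (x + e * t - z) - e * t by ring.
  by rewrite (le_lt_trans (ler_normB _ _))// net; lra.
move=> [_ _ _ zlip zlow].
(* [s] is the signed distance from [y = x + e t] to [z] in the direction [e] *)
pose s := e * (z - (x + e * t)).
have ns : `|s| = `|x + e * t - z| by rewrite normrM e1 mul1r distrC.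
rewrite -ns in zy.
have zE : z - e * (t + s) = x.
  by rewrite /s mulrDr mulrA ee mul1r; ring.
have sb := ltr_normlW zy.
have snb : - s < c * t by apply: le_lt_trans zy; rewrite -normrN ler_norm.
have := zlow (t + s); rewrite zE => /(_ _).
have -> : 0 < t + s < L^-1 by apply/andP; split; lra.
move=> /(_ isT) qts.
have := zlip (x + e * t); rewrite distrC -ns => /(_ _).
have -> : `|s| < L^-1 by lra.
move=> /(_ isT) zs.
have tri : `|f x - f z| <= `|f (x + e * t) - f x| + `|f z - f (x + e * t)|.
  rewrite (distrC (f (x + _)) (f x)) (distrC (f z)).
  exact: ler_distD.
have h1 : L * `|s| < L * (c * t) by rewrite ltr_pM2l.
have h2 : q * (- s) < q * (c * t) by rewrite ltr_pM2l//; lra.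
have h3 : (c * (L + q)) * t = q * t - p * t by rewrite cE; ring.
(* Now [q t - q c t < q (t + s) <= |f x - f z| < p t + L c t], against [c (L + q) = q - p]. *)
by nra.
Qed.

Lemma pointwise_lipschitz_ex : pointwise_lipschitz f -> forall x,
  exists K d : R, 0 < d /\
    forall y, `|x - y| < d -> `|f x - f y| <= K * `|x - y|.
Proof.
move=> hf x; have [K [hK _]] := lte_dense_real _ _ _ (hf x).
have [V [d /= d0 dV] VK] := limf_esup_lt _ _ _ hK.
exists K, d; split => // y xy.
have [->|yx] := eqVneq y x; first by rewrite !subrr !normr0 mulr0.
have := VK y; rewrite lte_fin => /(_ _)/ltW; rewrite ler_pdivrMr; last first.
  by rewrite normr_gt0 subr_eq0 eq_sym.
by apply; apply: dV.
Qed.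

Lemma mD_gap_cover : pointwise_lipschitz f -> forall e x,
  (mD e x < mD (- e) x)%E ->
  exists (p q : rat) (n : nat), mD_gap e (ratr p) (ratr q) n.+1%:R x.
Proof.
move=> hf e x /lte_dense_rat2[p [q [xp pq qx]]].
have [K [d [d0 lip]]] := pointwise_lipschitz_ex hf x.
have [V /at_right0_ex[d' d'0 dV] Vq] := limf_einf_gt _ _ _ qx.
(* An integer [L] above [M] dominates [K] and has [1 / L] below both [d] and [d']. *)
pose M := Num.max K (Num.max d^-1 d'^-1).
exists p, q, (Num.truncn M).
have : M < (Num.truncn M).+1%:R by exact: truncnS_gt.
set L := _.+1%:R; rewrite !gt_max => /and3P[KL dL d'L].
have L0 : 0 < L by rewrite ltr0n.
split=> //.
- move=> y xy; apply: (le_trans (lip y _)).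
    by apply: lt_trans xy _; rewrite invf_plt.
  by rewrite ler_wpM2r// ltW.
- move=> t /andP[t0 tL].
  have /Vq : V t by apply: dV; rewrite t0 (lt_trans tL)// invf_plt.
  by rewrite lte_fin ltr_pdivlMr// mulNr => /ltW.
Qed.

End derived_numbers.

Lemma sigma_porous_countable (R : realType) (I : countType) (N : set R)
    (G : I -> set R) :
  (forall i, porous (G i)) -> N = \bigcup_i G i -> sigma_porous N.
Proof.
move=> hG ->.
(* Numbers that code no index receive the empty set, which is vacuously porous. *)
exists (fun k => if unpickle k is Some i then G i else set0); split.
  by move=> k; case: unpickle => // x [].
apply/seteqP; split=> x.
  by move=> [i _ Gix]; exists (pickle i) => //; rewrite pickleK.
by move=> [k _]; case: unpickle => // i Gix; exists i.
Qed.

Theorem theorem3p4 (R : realType) (X : completeNormedModType R) (f : R -> X)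
    (hf : pointwise_lipschitz f) :
  sigma_porous [set x : R | mD_plus f x <> mD_minus f x].
Proof.
pose G (i : bool * rat * rat * nat) :=
  let: (b, p, q, n) := i in
  mD_gap f ((-1) ^+ b) (ratr p) (ratr q) n.+1%:R.
apply: (@sigma_porous_countable _ _ _ G).
  by move=> [[[b p] q] n]; apply: porous_mD_gap; rewrite ?normr_sign ?ltr0n.
apply/seteqP; split=> x /=; rewrite mD_plusE mD_minusE.
  move=> /eqP; rewrite neq_lt => /orP[].
    move=> /(mD_gap_cover _ hf)[p [q [n xG]]].
    by exists (false, p, q, n).
  rewrite -{2}(opprK 1) => /(mD_gap_cover _ hf)[p [q [n xG]]].
  by exists (true, p, q, n).
(* Conversely, [p < q] separates the derived numbers in directions [e] and [- e], for either
   sign. *)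
move=> [[[[b p] q] n] _ [xp pq qx _ _]].
have : (mD f ((-1) ^+ b) x < mD f (- (-1) ^+ b) x)%E.
  by apply: lt_trans xp (lt_trans _ qx); rewrite lte_fin.
by case: b {xp qx}; rewrite ?expr1 ?expr0 ?opprK => h E; rewrite E ltxx in h.
Qed.
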